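(* Let $(X,\|\cdot\|)$ be an AM-space with unit, let $G$ be an open subset of $X$ and let $F:G\to G$ be a nonexpansive map with respect to $\|\cdot\|$ (i.e. $\|F(x)-F(y)\|\le\|x-y\|$ for all $x,y\in G$). If $F$ has a fixed point $v\in G$ and if $F$ is semidifferentiable at $v$ with $\tilde r(F'_v)<1$, then the fixed point of $F$ in $G$ is unique. Moreover, if $G$ is connected, we have $$\limsup_{k\to\infty}\|F^k(x)-v\|^{1/k}\le\tilde r(F'_v)\qquad\text{for all }x\in G.$$
   Context: AM-space with unit: a (real) Banach lattice $(X,\|\cdot\|,\le)$ equipped with a distinguished element $e\ge0$ (the unit) such that $\|x\|=\inf\{a\ge0\mid -ae\le x\le ae\}$ for all $x\in X$ (equivalently, up to isometric lattice isomorphism, $X=\mathscr C(K)$ with the sup-norm for a compact Hausdorff space $K$, with $e$ the constant function $1$). Semidifferentiability: let $G\subset X$ and $v$ an interior point of $G$. A map $F:G\to X$ is semidifferentiable at $v$ if there exists a continuous, positively homogeneous map $h:X\to X$ (i.e. $h(tx)=th(x)$ for all $t>0$, $x\in X$) such that $F(v+x)=F(v)+h(x)+o(\|x\|)$ as $x\to0$. Such $h$ is unique and denoted $F'_v$ (the semidifferential of $F$ at $v$). Bonsall's spectral radius: for a continuous positively homogeneous self-map $h$ of $(X,\|\cdot\|)$, put $\|h\|=\sup_{x\ne0}\|h(x)\|/\|x\|<\infty$ and $\tilde r(h)=\lim_{k\to\infty}\|h^k\|^{1/k}=\inf_{k\ge1}\|h^k\|^{1/k}$, where $h^k$ is the $k$-th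 iterate. Similarly $F^k$ is the $k$-th iterate of $F$. *)

(* Defs.v *)
From HB Require Import structures.
From mathcomp Require Import all_boot all_order all_algebra.
From mathcomp Require Import all_classical all_reals all_analysis.

Set Implicit Arguments.
Unset Strict Implicit.
Unset Printing Implicit Defensive.
Import Order.TTheory GRing.Theory Num.Theory.
Import numFieldNormedType.Exports.

Local Open Scope classical_set_scope.
Local Open Scope ring_scope.

(* The order and the lattice operations are fields of the mixin:
   Hierarchy-Builder refuses a structure inheriting both [Order.Lattice] and
   [CompleteNormedModule], because their pairwise joins would have to be declared
   below the existing [NumDomain] and [RealDomain].  The modulus of [x] is
   [vjoin x (- x)]; the notation [`|x|] is the norm. *)
HB.mixin Record isBanachLattice (R : realType) X
    of CompleteNormedModule R X := {
  vle : rel X ;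
  vjoin : X -> X -> X ;
  vmeet : X -> X -> X ;
  vle_refl : reflexive vle ;
  vle_anti : antisymmetric vle ;
  vle_trans : transitive vle ;
  vle_joinl : forall x y : X, vle x (vjoin x y) ;
  vle_joinr : forall x y : X, vle y (vjoin x y) ;
  vjoin_le : forall x y z : X, vle x z -> vle y z -> vle (vjoin x y) z ;
  vmeet_lel : forall x y : X, vle (vmeet x y) x ;
  vmeet_ler : forall x y : X, vle (vmeet x y) y ;
  vle_meet : forall x y z : X, vle z x -> vle z y -> vle z (vmeet x y) ;
  vle_add2r : forall x y z : X, vle x y -> vle (x + z) (y + z) ;
  vle_scale2l : forall (a : R) (x y : X),
    0 <= a -> vle x y -> vle (a *: x) (a *: y) ;
  vle_norm : forall x y : X,
    vle (vjoin x (- x)) (vjoin y (- y)) -> `|x| <= `|y|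
}.

#[short(type="banachLatticeType")]
HB.structure Definition BanachLattice (R : realType) :=
  {X of isBanachLattice R X & CompleteNormedModule R X}.

(* The set in [am_normE] is necessarily nonempty: otherwise its [inf] is 0 by
   convention, hence [x = 0], for which the set contains 0. *)
HB.mixin Record BanachLattice_isAMSpaceWithUnit (R : realType) X
    of BanachLattice R X := {
  am_unit : X ;
  am_unit_ge0 : vle 0 am_unit ;
  am_normE : forall x : X,
    `|x| = inf [set a : R | [/\ 0 <= a, vle (- (a *: am_unit)) x
                                & vle x (a *: am_unit)]]
}.

#[short(type="amSpaceWithUnitType")]
HB.structure Definition AMSpaceWithUnit (R : realType) :=
  {X of BanachLattice_isAMSpaceWithUnit R X & BanachLattice R X}.

Definition nonexpansive_on (R : realType) (X : normedModType R) (G : set X)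
    (F : X -> X) : Prop :=
  forall x y, G x -> G y -> `|F x - F y| <= `|x - y|.

Definition pos_homogeneous (R : realType) (X : normedModType R)
    (h : X -> X) : Prop :=
  forall (t : R) (x : X), 0 < t -> h (t *: x) = t *: h x.

(* Only the germ of [F] at [v] matters, so that for a map defined on [G] the
   values outside [G] are irrelevant when [v] is interior to [G]. *)
Definition is_semidifferential (R : realType) (X : normedModType R)
    (F : X -> X) (v : X) (h : X -> X) : Prop :=
  [/\ continuous h, pos_homogeneous h &
      (fun x => F (v + x) - F v - h x) =o_ (0 : X) id].

Definition semidifferentiable (R : realType) (X : normedModType R)
    (F : X -> X) (v : X) : Prop :=
  exists h, is_semidifferential F v h.

(* Meaningful only under [semidifferentiable F v]; the [h] chosen is then the
   only one. *)
Definition semidifferential (R : realType) (X : normedModType R)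
    (F : X -> X) (v : X) : X -> X :=
  xget (fun=> 0) [set h | is_semidifferential F v h].

(* For [X = {0}] this is [sup set0 = 0]. *)
Definition hnorm (R : realType) (X : normedModType R) (h : X -> X) : R :=
  sup [set `|h x| / `|x| | x in [set x : X | x != 0]].

Definition bonsall_radius (R : realType) (X : normedModType R)
    (h : X -> X) : R :=
  limn (fun k : nat => hnorm (iter k h) `^ (k%:R^-1)).

(* Main.v *)
Require Import Defs.
From HB Require Import structures.
From mathcomp Require Import all_boot all_order all_algebra.
From mathcomp Require Import all_classical all_reals all_analysis.
From mathcomp Require Import lra.

(* Write [h] for the semidifferential and [r] for its spectral radius. Since [F]
   is nonexpansive so is [h], hence [F^n] is semidifferentiable at [v] with
   semidifferential [h^n]; if [r < mu], some [F^n] thus contracts distances to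
   [v] by the factor [mu^n] on a ball [B(v, d)].

   Uniqueness: if [w] is another fixed point, a point [x] of the segment [v, w]
   with [|x - v| < d] satisfies [|F^n x - w| <= |x - w|] and
   [|F^n x - v| < |x - v|], contradicting the triangle inequality.

   Rate: by nonexpansiveness the basin of [v] is open and closed in [G], hence
   equal to [G] when [G] is connected, and an orbit that has entered [B(v, d)]
   converges at rate [mu]. *)

Set Implicit Arguments.
Unset Strict Implicit.
Unset Printing Implicit Defensive.
Import Order.TTheory GRing.Theory Num.Theory.
Import numFieldNormedType.Exports.

Local Open Scope classical_set_scope.
Local Open Scope ring_scope.

(** * Geometric bounds and limits of [k]-th roots *)

Lemma geometric_bound (R : realType) (u : R^nat) (mu : R) (n N : nat) :
  (0 < n)%N -> 0 < mu -> (forall k, 0 <= u k) ->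
  (forall k, (N <= k)%N -> u (k + n)%N <= mu ^+ n * u k) ->
  exists2 C, 0 < C & forall k, u k <= C * mu ^+ k.
Proof.
move=> n0 mu0 u0 un.
(* [C] dominates every ratio [u i / mu ^+ i] with [i < N + n]; later indices reduce to these by
   strides of [n]. The summand 1 makes [C] positive. *)
pose C := 1 + \sum_(i < N + n) u i / mu ^+ i.
have term0 i : 0 <= u i / mu ^+ i by rewrite divr_ge0// exprn_ge0// ltW.
exists C; first by rewrite ltr_wpDr// sumr_ge0.
elim/ltn_ind => k IH; case: (ltnP k (N + n)) => kN.
  rewrite -ler_pdivrMr ?exprn_gt0// /C (bigD1 (Ordinal kN))//= addrCA lerDl.
  by rewrite addr_ge0// sumr_ge0.
have nk : (n <= k)%N by apply: leq_trans kN; exact: leq_addl.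
have Nk : (N <= k - n)%N by rewrite leq_subRL// addnC.
have := un _ Nk; rewrite subnK// => /le_trans; apply.
have -> : C * mu ^+ k = mu ^+ n * (C * mu ^+ (k - n)).
  by rewrite mulrCA -exprD subnKC.
apply: ler_wpM2l; first exact/exprn_ge0/ltW.
by apply: IH; rewrite ltn_subrL n0 (leq_trans n0).
Qed.

(** The powers of [mu / (mu + e)] tend to 0 and so eventually fall below [C^-1]: the slack [e]
    absorbs the constant. *)
Lemma root_geometric_near (R : realType) (u : R^nat) (C mu e : R) :
  (forall k, 0 <= u k) -> 0 < mu -> 0 < C -> 0 < e ->
  (forall k, u k <= C * mu ^+ k) ->
  \forall k \near \oo, u k `^ k%:R^-1 <= mu + e.
Proof.
move=> u0 mu0 C0 e0 uC.
have mue : 0 < mu + e by rewrite addr_gt0.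
have q0 : 0 <= mu / (mu + e) by rewrite divr_ge0// ltW.
have q1 : `|mu / (mu + e)| < 1.
  by rewrite ger0_norm// ltr_pdivrMr// mul1r ltrDl.
have := cvg_expr q1 => /cvgrPdist_lt /(_ C^-1).
rewrite invr_gt0 => /(_ C0) small.
near=> k.
have k0 : (0 < k)%N by near: k; exact: nbhs_infty_gt.
have ukle : u k <= (mu + e) ^+ k.
  apply: (le_trans (uC k)).
  have : `|0 - (mu / (mu + e)) ^+ k| < C^-1 by near: k; exact: small.
  rewrite sub0r normrN normrX ger0_norm// expr_div_n.
  rewrite -[C^-1]div1r ltr_pdivlMr// mulrAC ltr_pdivrMr ?exprn_gt0// mul1r.
  by rewrite mulrC => /ltW.
have kV : (0 : R) <= k%:R^-1 by rewrite invr_ge0.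
apply: (le_trans (ge0_ler_powR kV _ _ ukle));
  rewrite ?nnegrE ?exprn_ge0 ?(ltW mue)//.
rewrite -powR_mulrn ?(ltW mue)// -powRrM divff ?pnatr_eq0 -?lt0n//.
by rewrite powRr1// ltW.
Unshelve. all: by end_near. Qed.

(** Fekete's lemma in multiplicative form. *)
Lemma submultiplicative_root_cvg (R : realType) (u : R^nat) :
  (forall k, 0 <= u k) -> (forall n k, u (n + k)%N <= u n * u k) ->
  u k `^ k%:R^-1 @[k --> \oo] -->
    inf [set u n `^ n%:R^-1 | n in [set n | (0 < n)%N]].
Proof.
move=> u0 uM; set I := [set _ | _ in _].
have I0 : I !=set0 by exists (u 1%N `^ 1%:R^-1), 1%N.
have Ilb : lbound I 0 by move=> _ [n _ <-]; exact: powR_ge0.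
have Iinf : has_inf I by split => //; exists 0.
apply/cvgrPdist_le => e e0.
have e2 : 0 < e / 2 by rewrite divr_gt0.
have [_ [n /= n0 <-] ltn] := inf_adherent e2 Iinf.
(* Half of [e] goes into choosing [n] with root below [mu], the other half into absorbing the
   constant of the geometric bound. *)
set mu := inf I + e / 2 in ltn.
have mu0 : 0 < mu by apply: le_lt_trans ltn; exact: powR_ge0.
have un : u n <= mu ^+ n.
  rewrite -(powR_mulrn n (ltW mu0)) -[leLHS]powRr1//.
  rewrite -[X in _ `^ X](@mulVf _ (n%:R : R)) ?pnatr_eq0 -?lt0n// powRrM.
  by apply: ge0_ler_powR => //; rewrite ?nnegrE ?powR_ge0 ?ltW.
have step k : (0 <= k)%N -> u (k + n)%N <= mu ^+ n * u k.
  by move=> _; rewrite addnC (le_trans (uM _ _))// ler_wpM2r.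
have [C C0 uC] := geometric_bound n0 mu0 u0 step.
have := root_geometric_near u0 mu0 C0 e2 uC; apply: filterS2 (nbhs_infty_gt 0).
move=> k k0 uk; rewrite ler_distlC.
have : inf I <= u k `^ k%:R^-1 by apply: ge_inf; [exists 0 | exists k].
rewrite /mu in uk; move: uk; set z := u k `^ _; lra.
Qed.

(** * Bonsall's norm and spectral radius *)

Lemma hnorm_ge0 (R : realType) (X : normedModType R) (h : X -> X) :
  0 <= hnorm h.
Proof.
rewrite /hnorm; set E := [set _ | _ in _].
have [[[r Er] Eub]|/sup_out -> //] := pselect (has_sup E).
by apply: le_trans (ub_le_sup Eub Er); case: Er => x _ <-; rewrite divr_ge0.
Qed.

Lemma hnorm_le (R : realType) (X : normedModType R) (h : X -> X) (M : R) :
  0 <= M -> (forall x, `|h x| <= M * `|x|) -> hnorm h <= M.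
Proof.
move=> M0 hM; rewrite /hnorm; set E := [set _ | _ in _].
have [->|/set0P E0] := eqVneq E set0; first by rewrite sup0.
by apply: ge_sup => // _ [x /= x0 <-]; rewrite ler_pdivrMr// normr_gt0.
Qed.

(** The bound [M] makes the [sup] in [hnorm] a genuine least upper bound instead of the default
    0. *)
Lemma le_hnormM (R : realType) (X : normedModType R) (h : X -> X) (M : R)
    (x : X) :
  (forall x, `|h x| <= M * `|x|) -> `|h x| <= hnorm h * `|x|.
Proof.
move=> hM; have [->|x0] := eqVneq x 0.
  by rewrite normr0 mulr0; have := hM 0; rewrite normr0 mulr0.
rewrite -ler_pdivrMr ?normr_gt0//; apply: ub_le_sup; last by exists x.
by exists M => _ [y /= y0 <-]; rewrite ler_pdivrMr ?normr_gt0.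
Qed.

Lemma iter_contraction (R : realType) (X : normedModType R) (h : X -> X)
    (k : nat) (x : X) :
  (forall x, `|h x| <= `|x|) -> `|iter k h x| <= `|x|.
Proof. by move=> h1; elim: k => //= k; exact/le_trans. Qed.

(** All iterates are bounded by 1, so their norms are finite and submultiplicative, and Fekete's
    lemma applies. *)
Lemma hnorm_iter_root_cvg (R : realType) (X : normedModType R) (h : X -> X) :
  (forall x, `|h x| <= `|x|) ->
  hnorm (iter k h) `^ k%:R^-1 @[k --> \oo] --> bonsall_radius h.
Proof.
move=> h1.
have h1k k x : `|iter k h x| <= 1 * `|x| by rewrite mul1r iter_contraction.
apply/cvg_ex.
exists (inf [set hnorm (iter n h) `^ n%:R^-1 | n in [set n | (0 < n)%N]]).
apply: (@submultiplicative_root_cvg R (fun k => hnorm (iter k h))).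
  by move=> k; exact: hnorm_ge0.
move=> n k; apply: hnorm_le; first by rewrite mulr_ge0 ?hnorm_ge0.
move=> x; rewrite iterD -mulrA.
apply: le_trans (le_hnormM _ (h1k n)) _.
by rewrite ler_wpM2l ?hnorm_ge0//; exact: le_hnormM (h1k k).
Qed.

Lemma bonsall_radius_ge0 (R : realType) (X : normedModType R) (h : X -> X) :
  (forall x, `|h x| <= `|x|) -> 0 <= bonsall_radius h.
Proof.
move=> h1; apply: limr_ge; first exact: cvgP (hnorm_iter_root_cvg h1).
by apply: nearW => k; exact: powR_ge0.
Qed.

Lemma bonsall_radius_lt (R : realType) (X : normedModType R) (h : X -> X)
    (mu : R) :
  (forall x, `|h x| <= `|x|) -> bonsall_radius h < mu ->
  exists2 n, (0 < n)%N & hnorm (iter n h) < mu ^+ n.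
Proof.
move=> h1 rmu.
have mu0 : 0 < mu := le_lt_trans (bonsall_radius_ge0 h1) rmu.
have [N _ HN] : \forall k \near \oo, hnorm (iter k h) `^ k%:R^-1 < mu.
  exact: (cvgr_lt _ (hnorm_iter_root_cvg h1)).
(* The successor keeps the exponent nonzero, so that the root can be undone. *)
exists N.+1 => //; have := HN N.+1 (leqnSn N) => /= ltN.
rewrite -[ltLHS]powRr1 ?hnorm_ge0//.
rewrite -[X in _ `^ X](@mulVf _ (N.+1%:R : R))// powRrM.
rewrite -powR_mulrn ?(ltW mu0)//.
by apply: gt0_ltr_powR => //; rewrite ?nnegrE ?powR_ge0 ?ltW.
Qed.

(** * Semidifferentials of nonexpansive maps *)

Lemma open_ball_sub (R : realType) (X : normedModType R) (G : set X) (v : X) :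
  open G -> G v -> exists2 r : R, 0 < r & forall z, `|z| < r -> G (v + z).
Proof.
move=> oG Gv.
have /nbhs_normP[r /= r0 rG] : nbhs v G by exact: open_nbhs_nbhs.
by exists r => // z zr; apply: rG => /=; rewrite opprD addNKr normrN.
Qed.

Lemma semidifferential_near (R : realType) (X : normedModType R) (F : X -> X)
    (v : X) (h : X -> X) (e : R) :
  is_semidifferential F v h -> 0 < e ->
  exists2 d : R, 0 < d &
    forall x, `|x| < d -> `|F (v + x) - F v - h x| <= e * `|x|.
Proof.
case=> _ _ /eqoP sdF e0.
by have [d /= d0 Hd] := nbhs_norm0P.1 (sdF e e0); exists d.
Qed.

(** By homogeneity [h x] is the limit of [(F (v + t *: x) - F v) / t] as [t] decreases to 0, and
    these quotients are nonexpansive in [x]. *)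
Lemma semidifferential_nonexpansive (R : realType) (X : normedModType R)
    (G : set X) (F : X -> X) (v : X) (h : X -> X) :
  open G -> G v -> nonexpansive_on G F -> is_semidifferential F v h ->
  forall x y, `|h x - h y| <= `|x - y|.
Proof.
move=> oG Gv neF sdF x y; have [_ hom _] := sdF.
apply/ler_addgt0Pr => e e0.
(* [M] exceeds both norms, so one [t] serves [x] and [y], and also their sum, so the two remainders
   total at most [t * e]. *)
pose M := 1 + `|x| + `|y|.
have M0 : 0 < M by rewrite /M ltr_pwDl// ltr_pwDl.
have eM : 0 < e / M by rewrite divr_gt0.
have [d d0 Hd] := semidifferential_near sdF eM.
have [r r0 Hr] := open_ball_sub oG Gv.
have [t t0 small] : exists2 t, 0 < t &
    forall z : X, `|z| < M -> `|t *: z| < Num.min d r.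
  have m0 : 0 < Num.min d r by rewrite lt_min d0.
  exists (Num.min d r / M); first by rewrite divr_gt0.
  move=> z zM; rewrite normrZ gtr0_norm ?divr_gt0//.
  by rewrite mulrAC ltr_pdivrMr// ltr_pM2l.
have /small : `|x| < M by rewrite /M -addrA addrCA ltrDl ltr_pwDl.
rewrite lt_min => /andP[/Hd Hx /Hr Gx].
have /small : `|y| < M by rewrite /M ltrDr ltr_pwDl.
rewrite lt_min => /andP[/Hd Hy /Hr Gy].
have := neF _ _ Gx Gy; rewrite opprD addrACA subrr add0r -scalerBr => Hxy.
rewrite -(ler_pM2l t0) -{1}(gtr0_norm t0) -normrZ scalerBr -!hom//.
move: Hx Hy Hxy; rewrite !normrZ !gtr0_norm//.
have ab : `|F (v + t *: x) - F (v + t *: y)| =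
    `|(F (v + t *: x) - F v) - (F (v + t *: y) - F v)|.
  by rewrite opprB addrA subrK.
rewrite ab.
move: (F (v + t *: x) - F v) (F (v + t *: y) - F v) (h (t *: x)) (h (t *: y)).
move=> a b c g Hx Hy Hxy.
have tri : `|c - g| <= `|a - c| + `|a - b| + `|b - g|.
  rewrite (distrC a c) -addrA (le_trans (ler_distD a _ _))//.
  by rewrite lerD2l ler_distD.
have : e / M * (t * `|x|) + e / M * (t * `|y|) <= t * e.
  rewrite -mulrDr -mulrDr mulrCA ler_pM2l// mulrAC ler_pdivrMr// ler_pM2l//.
  by rewrite /M -addrA lerDr.
rewrite mulrDr; lra.
Qed.

Lemma semidifferential_contraction (R : realType) (X : normedModType R)
    (G : set X) (F : X -> X) (v : X) (h : X -> X) :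
  open G -> G v -> nonexpansive_on G F -> is_semidifferential F v h ->
  forall x, `|h x| <= `|x|.
Proof.
move=> oG Gv neF sdF x.
have h0 : h 0 = 0.
  have [_ /(_ 2 0 (ltr0Sn _ _)) + _] := sdF; rewrite scaler0 scaler_nat mulr2n.
  by move/eqP; rewrite eq_sym -subr_eq0 addrK => /eqP.
by have := semidifferential_nonexpansive oG Gv neF sdF x 0; rewrite h0 !subr0.
Qed.

Lemma iter_nonexpansive_on (R : realType) (X : normedModType R) (G : set X)
    (F : X -> X) (k : nat) :
  set_fun G G F -> nonexpansive_on G F -> nonexpansive_on G (iter k F).
Proof.
move=> FG neF x y Gx Gy; elim: k => //= k; apply: le_trans.
by apply: neF; elim: k => //= k; exact: FG.
Qed.

(** Chain rule at a fixed point, by induction on [n]: [h] is nonexpansive, so it does not enlarge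
    the earlier error, and each step adds a remainder of [F]. *)
Lemma semidifferential_iter (R : realType) (X : normedModType R) (G : set X)
    (F : X -> X) (v : X) (h : X -> X) (n : nat) (e : R) :
  open G -> set_fun G G F -> nonexpansive_on G F -> G v -> F v = v ->
  is_semidifferential F v h -> 0 < e ->
  exists2 d : R, 0 < d &
    forall x, `|x| < d -> `|iter n F (v + x) - v - iter n h x| <= e * `|x|.
Proof.
move=> oG FG neF Gv Fv sdF; elim: n e => [|n IH] e e0.
  by exists 1 => // x _ /=; rewrite addrAC addrK subrr normr0 mulr_ge0// ltW.
have e2 : 0 < e / 2 by rewrite divr_gt0.
have [d1 d10 H1] := IH _ e2.
have [d2 d20 H2] := semidifferential_near sdF e2.
have [r r0 Hr] := open_ball_sub oG Gv.
exists (Num.min d1 (Num.min d2 r)); first by rewrite !lt_min d10 d20.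
move=> x; rewrite !lt_min => /and3P[/H1 x1 x2 /Hr Gx].
set y := iter n F (v + x) - v in x1.
have yx : `|y| <= `|x|.
  have := iter_nonexpansive_on n FG neF Gx Gv.
  by rewrite (iter_fix _ Fv) addrAC subrr add0r.
have := H2 y (le_lt_trans yx x2); rewrite Fv /= {1}/y subrKC => Fy.
have hy := semidifferential_nonexpansive oG Gv neF sdF y (iter n h x).
rewrite (le_trans (ler_distD (h y) _ _))// (splitr e) mulrDl lerD//.
  by rewrite (le_trans Fy)// ler_wpM2l// ltW.
exact: le_trans hy x1.
Qed.

Lemma semidifferential_local_contraction (R : realType) (X : normedModType R)
    (G : set X) (F : X -> X) (v : X) (h : X -> X) (mu : R) :
  open G -> set_fun G G F -> nonexpansive_on G F -> G v -> F v = v ->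
  is_semidifferential F v h -> bonsall_radius h < mu ->
  exists n, exists d : R, [/\ (0 < n)%N, 0 < d &
    forall x, `|x - v| < d -> G x /\ `|iter n F x - v| <= mu ^+ n * `|x - v|].
Proof.
move=> oG FG neF Gv Fv sdF rmu.
have h1 := semidifferential_contraction oG Gv neF sdF.
have [n n0 hn] := bonsall_radius_lt h1 rmu.
(* The gap between [mu ^+ n] and the norm of [iter n h] absorbs the remainder. *)
have e0 : 0 < mu ^+ n - hnorm (iter n h) by rewrite subr_gt0.
have [d d0 Hd] := semidifferential_iter n oG FG neF Gv Fv sdF e0.
have [r r0 Hr] := open_ball_sub oG Gv.
exists n, (Num.min d r); split => //; first by rewrite lt_min d0.
move=> x; rewrite lt_min => /andP[/Hd xd /Hr]; rewrite subrKC in xd *.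
move=> Gx; split => //.
have hx : `|iter n h (x - v)| <= hnorm (iter n h) * `|x - v|.
  by apply: (@le_hnormM _ _ _ 1) => z; rewrite mul1r iter_contraction.
move: xd; rewrite mulrBl => xd.
have := ler_distD (iter n h (x - v)) (iter n F x - v) 0.
rewrite !subr0; lra.
Qed.

(** * Uniqueness and the basin of attraction *)

Lemma local_contraction_fixpoint_unique (R : realType) (X : normedModType R)
    (G : set X) (F : X -> X) (v w : X) (n : nat) (d q : R) :
  set_fun G G F -> nonexpansive_on G F -> 0 < d -> q < 1 ->
  (forall x, `|x - v| < d -> G x /\ `|iter n F x - v| <= q * `|x - v|) ->
  G w -> F w = w -> w = v.
Proof.
move=> FG neF d0 q1 Fn Gw Fw; apply/eqP; rewrite -subr_eq0 -normr_le0 leNgt.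
apply/negP => D0; set D := `|w - v| in D0.
(* The first bound puts [x] within [d] of [v]; the second keeps it on the segment. *)
pose s := Num.min (d / 2 / D) (1 / 2).
have s0 : 0 < s by rewrite lt_min !divr_gt0.
have s1 : 0 <= 1 - s by rewrite subr_ge0 ge_min; apply/orP; right; lra.
have sD0 : 0 < s * D by rewrite mulr_gt0.
have sDd : s * D < d.
  apply: (@le_lt_trans _ _ (d / 2)); last by lra.
  by rewrite -ler_pdivlMr// ge_min lexx.
pose x := v + s *: (w - v).
have xv : `|x - v| = s * D by rewrite /x addrAC subrr add0r normrZ gtr0_norm.
have xw : `|x - w| = (1 - s) * D.
  rewrite distrC /D -(ger0_norm s1) -normrZ scalerBl scale1r.
  by rewrite /x opprD addrA.
have := Fn x; rewrite xv => /(_ sDd)[Gx yv].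
have := iter_nonexpansive_on n FG neF Gx Gw; rewrite (iter_fix _ Fw) xw => yw.
have := ler_distD (iter n F x) w v; rewrite (distrC w (iter n F x)) -/D.
have : q * (s * D) < s * D by rewrite gtr_pMl.
rewrite mulrBl mul1r in yw; lra.
Qed.

Lemma local_contraction_attracts (R : realType) (X : normedModType R)
    (F : X -> X) (v x : X) (n : nat) (d q e : R) :
  0 <= q < 1 -> 0 < e ->
  (forall x, `|x - v| < d -> `|iter n F x - v| <= q * `|x - v|) ->
  `|x - v| < d -> exists m, `|iter m F x - v| < e.
Proof.
move=> /andP[q0 q1] e0 Fn xd.
have Fj j : `|iter (j * n) F x - v| <= q ^+ j * `|x - v|.
  elim: j => [|j IH]; first by rewrite mul1r.
  rewrite mulSn iterD exprS -mulrA.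
  apply: le_trans (Fn _ _) _; last by rewrite ler_wpM2l.
  apply: le_lt_trans IH (le_lt_trans _ xd).
  by rewrite ler_piMl// exprn_ile1// ltW.
have d0 : 0 < d := le_lt_trans (normr_ge0 _) xd.
have q1' : `|q| < 1 by rewrite ger0_norm.
have /cvgrPdist_lt/(_ (e / d)) := cvg_expr q1'.
rewrite divr_gt0// => /(_ isT)[j _ /(_ j (leqnn j))] /=.
rewrite sub0r normrN ger0_norm ?exprn_ge0// ltr_pdivlMr// => qj.
exists (j * n)%N; apply: le_lt_trans (Fj j) (le_lt_trans _ qj).
by rewrite ler_wpM2l ?exprn_ge0// ltW.
Qed.

(* By nonexpansiveness, a point of [G] within [d / 2] of a point of the basin
   of [v] enters [ball v d]: the basin is both open and closed in [G]. *)
Lemma connected_basin (R : realType) (X : normedModType R) (G : set X)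
    (F : X -> X) (v x : X) (n : nat) (d q : R) :
  set_fun G G F -> nonexpansive_on G F -> 0 < d -> 0 <= q < 1 ->
  (forall x, `|x - v| < d -> G x /\ `|iter n F x - v| <= q * `|x - v|) ->
  connected G -> G x -> exists m, `|iter m F x - v| < d.
Proof.
move=> FG neF d0 q01 Fn cG Gx.
have d2 : 0 < d / 2 by rewrite divr_gt0.
(* The radius [d / 2] leaves room for a displacement of [d / 2] inside the ball of radius [d]; local
   attraction then brings the orbit back within [d / 2]. *)
pose B : set X := [set y | G y /\ exists m, `|iter m F y - v| < d / 2].
have nearB y z : B y -> G z -> `|y - z| < d / 2 -> B z.
  move=> [Gy [m ym]] Gz yz; split => //.
  have zm : `|iter m F z - v| < d.
    rewrite (le_lt_trans (ler_distD (iter m F y) _ _))// (splitr d) ltrD//.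
    rewrite distrC; exact: le_lt_trans (iter_nonexpansive_on m FG neF Gy Gz) yz.
  have [k zk] := local_contraction_attracts q01 d2 (fun x xd => (Fn x xd).2) zm.
  by exists (k + m)%N; rewrite iterD.
have BG : B = G.
  apply: cG.
  - exists v; split; first by have [] := Fn v; rewrite ?subrr ?normr0.
    by exists 0%N; rewrite /= subrr normr0.
  - exists (\bigcup_(y in B) ball y (d / 2)).
      by apply: bigcup_open => y _; exact: ball_open.
    apply/seteqP; split=> [y By|z [Gz [y By]]].
      by split; [case: By | exists y => //; exact: ballxx].
    by rewrite -ball_normE; exact: nearB.
  - exists (closure B); first exact: closed_closure.
    apply/seteqP; split=> [y By|z [Gz Bz]].
      by split; [case: By | exact: subset_closure].
    have [y [By]] := Bz _ (nbhsx_ballx z _ d2).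
    by rewrite -ball_normE /= distrC; exact: nearB.
move: Gx; rewrite -BG => -[_ [m xm]]; exists m.
by rewrite (lt_trans xm)// ltr_pdivrMr// ltr_pMr// ltr1n.
Qed.

(** [limn_esup] is an infimum of suprema over the sets of the filter; the set where [u k <= M] is
    one of them. *)
Lemma limn_esup_le_near (R : realType) (u : R^nat) (M : R) :
  (\forall k \near \oo, u k <= M) ->
  (limn_esup (fun k => (u k)%:E) <= M%:E)%E.
Proof.
move=> uM; apply: ge_ereal_inf.
exists (ereal_sup [set (u k)%:E | k in [set k | u k <= M]]).
  by exists [set k | u k <= M].
by apply: ge_ereal_sup => _ [k /= kM <-]; rewrite lee_fin.
Qed.

Theorem corollary10p2 (R : realType) (X : amSpaceWithUnitType R)
    (G : set X) (F : X -> X) (v : X) :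
  open G ->
  set_fun G G F ->
  nonexpansive_on G F ->
  G v -> F v = v ->
  semidifferentiable F v ->
  bonsall_radius (semidifferential F v) < 1 ->
  (forall w : X, G w -> F w = w -> w = v) /\
  (connected G ->
   forall x : X, G x ->
   (limn_esup (fun k : nat => (`|iter k F x - v| `^ (k%:R^-1))%:E)
      <= (bonsall_radius (semidifferential F v))%:E)%E).
Proof.
move=> oG FG neF Gv Fv [h0 sdh0].
have sdF : is_semidifferential F v (semidifferential F v).
  by rewrite /semidifferential; case: xgetP => [h _ //|/(_ _ sdh0)].
set h := semidifferential F v in sdF *; set r := bonsall_radius h => r1.
have r0 : 0 <= r :=
  bonsall_radius_ge0 (semidifferential_contraction oG Gv neF sdF).
split.
  have [mu rmu mu1] : exists2 mu, r < mu & mu < 1 by exists ((r + 1) / 2); lra.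
  have [n [d [n0 d0 Fn]]] :=
    semidifferential_local_contraction oG FG neF Gv Fv sdF rmu.
  have q1 : mu ^+ n < 1 by rewrite exprn_ilt1// ?(le_trans r0) ?ltW// -lt0n.
  by move=> w; exact: local_contraction_fixpoint_unique Fn.
move=> cG x Gx; apply/lee_addgt0Pr => e e0; rewrite -EFinD.
(* [mu < 1] lets the orbit enter the ball; the remaining [e / 2] absorbs the constant [C] below. *)
have [mu [rmu mu1 mue]] : exists mu, [/\ r < mu, mu < 1 & mu <= r + e / 2].
  exists (r + Num.min (e / 2) ((1 - r) / 2)).
  by case: (leP (e / 2)) => ?; split; lra.
have mu0 : 0 < mu := le_lt_trans r0 rmu.
have e2 : 0 < e / 2 by rewrite divr_gt0.
have [n [d [n0 d0 Fn]]] :=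
  semidifferential_local_contraction oG FG neF Gv Fv sdF rmu.
have q01 : 0 <= mu ^+ n < 1.
  by rewrite exprn_ge0 ?exprn_ilt1 ?ltW// -lt0n.
have [m xm] := connected_basin FG neF d0 q01 Fn cG Gx.
(* Once inside the ball the orbit stays there, since [F] is nonexpansive and fixes [v]. *)
have step k : (m <= k)%N ->
    `|iter (k + n) F x - v| <= mu ^+ n * `|iter k F x - v|.
  move=> mk; rewrite addnC iterD; apply: (Fn _ _).2; apply: le_lt_trans xm.
  rewrite -(subnK mk) iterD.
  have Gm : G (iter m F x) by elim: (m) => //= j; exact: FG.
  by have := iter_nonexpansive_on (k - m) FG neF Gm Gv; rewrite (iter_fix _ Fv).
have [C C0 uC] := geometric_bound n0 mu0 (fun=> normr_ge0 _) step.
apply: limn_esup_le_near.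
apply: filterS (root_geometric_near (fun=> normr_ge0 _) mu0 C0 e2 uC).
move=> k /le_trans; apply; lra.
Qed.
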